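(* For every $n\in\mathbb{N}$ with $10\mid n$, $m(n,11)=m(n,2^{5-1}-5)=\frac{2^5-5-\frac12}{5}\,n=5.3\,n$. Consequently $m(11)=5.3$.
   Context: For non-negative integers $n,m,a,b$ write $(n,m)\to(a,b)$ if for every $n$-element set $V$ and every family $\mathcal{F}\subseteq 2^{V}$ with $|\mathcal{F}|\ge m$ there is an $a$-element set $T\subseteq V$ with $|\mathcal{F}_{|T}|\ge b$, where $\mathcal{F}_{|T}=\{F\cap T: F\in\mathcal{F}\}$. For non-negative integers $n,s$, $m(n,s)$ denotes the maximum integer $m$ such that $(n,m)\to(n-1,m-s)$. For fixed $s$, $m(s)=\lim_{n\to\infty} m(n,s)/n$ (this limit exists). *)

(* Defs.v *)
From mathcomp Require Import all_boot.
From Stdlib Require Import Reals.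
Set Implicit Arguments.
Unset Strict Implicit.
Unset Printing Implicit Defensive.

Definition trace (V : finType) (F : {set {set V}}) (T : {set V}) : {set {set V}} :=
  [set F' :&: T | F' in F].

Definition arrow (n m a b : nat) : bool :=
  [forall F : {set {set 'I_n}}, (m <= #|F|) ==>
     [exists T : {set 'I_n}, (#|T| == a) && (b <= #|trace F T|)]].

(* m(n,s): the maximum m (among the meaningful values m <= 2^n) with
   (n,m) -> (n-1, m-s).  Note m - s is truncated subtraction; when m <= s
   the target requirement |F_|T| >= m - s <= 0 is trivial either way. *)
Definition mns (n s : nat) : nat :=
  \max_(m < (2 ^ n).+1 | arrow n m n.-1 (m - s)) m.

Definition ms_is (s : nat) (L : R) : Prop :=
  Un_cv (fun n => Rdiv (INR (mns n s)) (INR n)) L.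

(* Main.v *)
Require Import Defs.
From mathcomp Require Import all_boot zify.
From Stdlib Require Import Reals Lra.
Set Implicit Arguments.
Unset Strict Implicit.
Unset Printing Implicit Defensive.

(** Down-compression reduces both bounds to hereditary families, for which restricting
    to the complement of [x] loses exactly the sets through [x]. So one has to show that a
    hereditary family on [n] points, each contained in at least 12 members, has at least
    [5.3 n] nonempty members.

    Spread every nonempty set evenly over its points: in units of 1/60, and ignoring sets of
    more than 4 points, a point lying in [a], [b], [c] sets of sizes 2, 3, 4 gets
    [60 + 30 a + 20 b + 15 c]. The required average is 318, and only two kinds of points
    are below it: type A with [(a, b, c) = (4, 5, 2)] and weight 310, and type B with
    [(a, b, c) = (4, 6, 1)] and weight 315. Such points are compensated by their
    neighbours through a local discharging rule.

    For the matching construction, take two 5-point sets, in each of them all sets of size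
    at most 3 and a single 4-set, and join by an edge the two points that the 4-sets miss:
    this is a family with 53 nonempty sets on 10 points, every one of degree at least 12. *)

(** * Down-compression *)

Definition hereditary (V : finType) (F : {set {set V}}) :=
  forall (S : {set V}) (x : V), S \in F -> S :\ x \in F.

Lemma hereditary_sub (V : finType) (F : {set {set V}}) (S R : {set V}) :
  hereditary F -> S \in F -> R \subset S -> R \in F.
Proof.
move=> her; have [k] := ubnP #|S :\: R|.
elim: k S => // k IH S ltk SF RS.
have [|/set0Pn [x xSR]] := boolP (S :\: R == set0).
  by rewrite setD_eq0 => SR; have /eqP <- : S == R by rewrite eqEsubset SR.
have /setDP [xS xR] := xSR.
apply: (IH (S :\ x)); first last.
- by rewrite subsetD1 RS.
- exact: her.
have -> : (S :\ x) :\: R = (S :\: R) :\ x by rewrite !setDDl setUC.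
by move: ltk; rewrite (cardsD1 x (S :\: R)) xSR.
Qed.

Section Compression.

Variable V : finType.
Implicit Types (F : {set {set V}}) (S T : {set V}) (x : V).

(** The down-shift at [x], acting on one set; the shifted family is the image [down F x @: F]. *)
Definition down F x S := if S :\ x \in F then S else S :\ x.

Lemma setD1_id S x : x \notin S -> S :\ x = S.
Proof. by move=> xS; apply/setDidPl; rewrite disjoint_sym disjoints1. Qed.

(** A moved member contains [x], so two moved members with equal images coincide. A moved member
    lands outside [F], hence never on a kept one. *)
Lemma down_inj F x : {in F &, injective (down F x)}.
Proof.
move=> S S' SF SF'; rewrite /down.
case: ifPn => h; case: ifPn => h' //.
- by move=> eS; rewrite -eS SF in h'.
- by move=> eS; rewrite eS SF' in h.
have xS : x \in S by apply: contraNT h => /setD1_id ->.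
have xS' : x \in S' by apply: contraNT h' => /setD1_id ->.
by move=> eS; rewrite -(setD1K xS) -(setD1K xS') eS.
Qed.

(** If [x] is outside [T], shifting creates no new trace. Otherwise the trace of the shifted family
    lies inside the down-shift of [trace F T], which is no larger than [trace F T]. *)
Lemma trace_down F x T :
  #|trace (down F x @: F) T| <= #|trace F T|.
Proof.
have tr S : S \in F -> S :&: T \in trace F T by move=> SF; apply: imset_f.
have [xT|xT] := boolP (x \in T); last first.
  apply/subset_leq_card/subsetP=> _ /imsetP [_ /imsetP [S SF ->] ->].
  rewrite /down; case: ifP => _; first exact: tr.
  by rewrite setIDAC setD1_id ?tr // inE (negbTE xT) andbF.
apply: leq_trans (leq_imset_card (down (trace F T) x) _).
apply/subset_leq_card/subsetP=> _ /imsetP [_ /imsetP [S SF ->] ->].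
rewrite {1}/down; case: ifPn => h.
  apply/imsetP; exists (S :&: T); first exact: tr.
  by rewrite /down -setIDAC tr.
rewrite setIDAC; have [h'|h'] := boolP ((S :&: T) :\ x \in trace F T).
  apply/imsetP; exists ((S :&: T) :\ x) => //.
  by rewrite /down setDDl setUid h'.
apply/imsetP; exists (S :&: T); first exact: tr.
by rewrite /down (negbTE h').
Qed.

(** Among the families with the required cardinality and trace bounds, take one of minimal total
    size. If some [S :\ x] were missing, the down-shift at [x] would keep the bounds and lower the
    total. *)
Lemma hereditary_compression F :
  exists G : {set {set V}},
    [/\ hereditary G, #|G| = #|F| & forall T, #|trace G T| <= #|trace F T|].
Proof.
pose P (G : {set {set V}}) :=
  (#|G| == #|F|) && [forall T : {set V}, #|trace G T| <= #|trace F T|].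
have P0 : P F by rewrite /P eqxx; apply/forallP=> T.
case: (arg_minnP (fun G : {set {set V}} => \sum_(S in G) #|S|) P0) => G.
case/andP=> /eqP cG /forallP tG minG; exists G; split=> //.
move=> S x SG; apply: contraT => SxG.
have : P (down G x @: G).
  rewrite /P card_in_imset ?cG ?eqxx; last exact: down_inj.
  by apply/forallP=> T; apply: leq_trans (trace_down _ _ _) (tG T).
move/minG; rewrite big_imset; last exact: down_inj.
rewrite leqNgt => /negP []; rewrite [ltnRHS](bigD1 S) //= (bigD1 S) //=.
rewrite -addSn leq_add //.
  rewrite /down (negbTE SxG).
  by apply: proper_card; apply: properD1; apply: contraNT SxG => /setD1_id ->.
apply: leq_sum => R _; rewrite /down; case: ifP => // _.
by apply: subset_leq_card; apply: subsetDl.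
Qed.

(** By heredity the trace on the complement of [x] is exactly the subfamily of members avoiding
    [x]. *)
Lemma card_trace_hereditary F x : hereditary F ->
  #|trace F (~: [set x])| + #|[set S in F | x \in S]| = #|F|.
Proof.
move=> her.
have -> : trace F (~: [set x]) = [set S in F | x \notin S].
  apply/setP=> S; rewrite inE; apply/imsetP/andP => [[R RF ->]|[SF xS]].
    by rewrite -setDE her // !inE eqxx.
  by exists S; rewrite // -setDE setD1_id.
by rewrite addnC -(cardsID [set S : {set V} | x \in S] F); congr (_ + _);
  apply: eq_card => S; rewrite !inE andbC.
Qed.

End Compression.

(** * Degrees in a set family *)

Section Degrees.

Variables (V : finType) (F : {set {set V}}).
Implicit Types (A B C S : {set V}) (x y z : V).

Definition deg k A := #|[set S in F | (#|S| == k) && (A \subset S)]|.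

Lemma degE k A :
  deg k A = \sum_(S in F | (#|S| == k) && (A \subset S)) 1.
Proof. by rewrite /deg -sum1_card; apply: eq_bigl => S; rewrite inE. Qed.

(** Double counting of pairs [(z, S)] with [z] in [S :\: A]. *)
Lemma deg_sum k A :
  \sum_(z | z \notin A) deg k (z |: A) = (k - #|A|) * deg k A.
Proof.
under eq_bigr => z _ do rewrite degE.
rewrite (exchange_big_dep (fun S => [&& S \in F, #|S| == k & A \subset S])) /=.
  rewrite degE big_distrr /=; apply: eq_bigr => S /and3P [SF /eqP cS AS].
  have -> : k - #|A| = #|S :\: A| by rewrite cardsD (setIidPr AS) cS.
  rewrite muln1 -[RHS]sum1_card; apply: eq_bigl => z.
  by rewrite !inE SF cS eqxx subUset sub1set AS andbT.
by move=> z S _; rewrite subUset => /and3P [-> -> /andP []].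
Qed.

Lemma deg_self A : deg #|A| A = (A \in F).
Proof.
rewrite /deg; have [AF|AF] := boolP (A \in F).
  apply: etrans (cards1 A); apply: eq_card => S.
  rewrite !inE.
  apply/and3P/eqP => [[_ /eqP cS AS]|->]; last by rewrite eqxx.
  by apply/esym/eqP; rewrite eqEcard AS cS leqnn.
apply/eqP; rewrite cards_eq0; apply/eqP/setP => S; rewrite !inE.
apply/negbTE/negP => /and3P [SF /eqP cS AS].
have eAS : A = S by apply/eqP; rewrite eqEcard AS cS leqnn.
by rewrite eAS SF in AF.
Qed.

Lemma deg_eq0 k A : hereditary F -> A \notin F -> deg k A = 0.
Proof.
move=> her AF; apply/eqP; rewrite cards_eq0; apply/eqP/setP => S; rewrite !inE.
apply/negbTE/negP => /and3P [SF _ AS].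
by rewrite (hereditary_sub her SF AS) in AF.
Qed.

Lemma deg_gt0 A S : S \in F -> A \subset S -> 0 < deg #|S| A.
Proof. by move=> SF AS; apply/card_gt0P; exists S; rewrite !inE SF AS eqxx. Qed.

Lemma deg_subset k A B : A \subset B -> deg k B <= deg k A.
Proof.
move=> AB; apply/subset_leq_card/subsetP=> S; rewrite !inE.
by case/and3P=> -> -> BS; rewrite (subset_trans AB BS).
Qed.

(** Inclusion-exclusion among the [k]-sets through [A]. *)
Lemma deg_incl k A B C : A \subset B -> A \subset C ->
  deg k B + deg k C <= deg k A + deg k (B :|: C).
Proof.
move=> AB AC; rewrite -cardsUI; apply: leq_add.
  apply/subset_leq_card/subsetP=> S; rewrite !inE.
  by case/orP=> /and3P [-> -> h] /=; apply: subset_trans h.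
apply/subset_leq_card/subsetP=> S; rewrite !inE subUset.
by case/andP=> /and3P [-> -> ->] /andP [_ /andP [_ ->]].
Qed.

Definition nbhd x := [set y | (y != x) && ([set x; y] \in F)].

Lemma card_nbhd x : hereditary F -> #|nbhd x| = deg 2 [set x].
Proof.
move=> her; have := deg_sum 2 [set x]; rewrite cards1 mul1n => <-.
rewrite -sum1_card [RHS](bigID (mem (nbhd x))) /= [X in _ + X]big1 ?addn0.
  rewrite big_mkcond [RHS]big_mkcond; apply: eq_bigr => y _.
  rewrite !inE; case: eqVneq => //= nyx; case: ifP => // yF.
  have -> : 2 = #|y |: [set x]| by rewrite cards2 nyx.
  by rewrite deg_self setUC yF.
move=> y; rewrite !inE => /andP [-> /= yF].
by rewrite deg_eq0 // setUC.
Qed.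

(** Removing [x] injects the sets counted on the left into the [k]-subsets of the neighbourhood of
    [x]. *)
Lemma deg1_bin k x : hereditary F ->
  deg k.+1 [set x] <= 'C(deg 2 [set x], k).
Proof.
move=> her; rewrite -card_nbhd // -cards_draws /deg.
rewrite -[leqLHS](card_in_imset (f := fun S => S :\ x)).
  apply/subset_leq_card/subsetP=> _ /imsetP [S + ->].
  rewrite !inE sub1set => /and3P [SF /eqP cS xS].
  apply/andP; split; last by move: cS; rewrite (cardsD1 x) xS add1n => -[->].
  apply/subsetP => y; rewrite !inE => /andP [-> yS].
  by apply: hereditary_sub her SF _; rewrite subUset !sub1set xS.
move=> S S'; rewrite !inE !sub1set => /and3P [_ _ xS] /and3P [_ _ xS'] e.
by rewrite -(setD1K xS) -(setD1K xS') e.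
Qed.

End Degrees.

Lemma subset_between (T : finType) (A B : {set T}) k :
  A \subset B -> #|A| <= k -> k <= #|B| ->
  exists R : {set T}, [/\ A \subset R, R \subset B & #|R| = k].
Proof.
have [m] := ubnP (k - #|A|); elim: m A => // m IH A ltm AB Ak kB.
have [eA|nA] := eqVneq #|A| k; first by exists A.
have [|z zB zA] := subsetPn (_ : ~~ (B \subset A)).
  by apply: contra nA => /subset_leq_card; lia.
have cz : #|z |: A| = #|A|.+1 by rewrite cardsU1 zA.
have [||||R [zR RB cR]] := IH (z |: A).
- by rewrite cz; lia.
- by rewrite subUset sub1set zB.
- by rewrite cz; lia.
- by [].
by exists R; split=> //; apply: subset_trans zR; apply: subsetUr.
Qed.

Lemma small_bin n : n <= 3 -> ('C(n, 2) <= 3) && ('C(n, 3) <= 1).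
Proof. by case: n => [|[|[|[|]]]]. Qed.

(** * Links of points: edges are 3-sets and triangles 4-sets through the point *)

Section Link.

Variables (V : finType) (F : {set {set V}}).
Hypothesis her : hereditary F.
Implicit Types (A B C S : {set V}) (x y z u v w : V).

Local Notation a x := (deg F 2 [set x]).
Local Notation b x := (deg F 3 [set x]).
Local Notation c x := (deg F 4 [set x]).
Local Notation p x y := (deg F 3 [set x; y]).
Local Notation q x y := (deg F 4 [set x; y]).
Local Notation N := (nbhd F).

Lemma mem_nbhd x y : (y \in N x) = (y != x) && ([set x; y] \in F).
Proof. by rewrite inE. Qed.

Lemma nbhdC x y : (y \in N x) = (x \in N y).
Proof. by rewrite !mem_nbhd eq_sym setUC. Qed.

Lemma nbhd_sub S x y : S \in F -> x \in S -> y \in S -> y != x -> y \in N x.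
Proof.
move=> SF xS yS nyx; rewrite mem_nbhd nyx; apply: hereditary_sub her SF _.
by rewrite subUset !sub1set xS.
Qed.

(** For a member [S] of size [k.+1] through [x], these are the sets [S :\ y] with [y] in [S :\ x];
    in the link of [x] they form the boundary of the face given by [S]. *)
Definition shadow k x S :=
  [set R in F | (#|R| == k) && ([set x] \subset R) & R \subset S].

Lemma card_shadow k x S : S \in F -> #|S| = k.+1 -> x \in S ->
  k <= #|shadow k x S|.
Proof.
move=> SF cS xS.
have cI : #|(fun y => S :\ y) @: (S :\ x)| = k.
  rewrite card_in_imset; first by move: cS; rewrite (cardsD1 x) xS add1n => -[].
  move=> y z; rewrite !inE => /andP [_ yS] /andP [_ zS] /setP /(_ y).
  by rewrite !inE eqxx yS !andbT => /esym /negbFE /eqP.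
rewrite -[leqLHS]cI; apply/subset_leq_card/subsetP=> _ /imsetP [y + ->].
rewrite !inE => /andP [nyx yS].
have -> : #|S :\ y| = k by move: cS; rewrite (cardsD1 y) yS add1n => -[].
by rewrite her // eqxx sub1set !inE eq_sym nyx xS subD1set.
Qed.

Lemma shadow_sub k x S :
  shadow k x S \subset [set R in F | (#|R| == k) && ([set x] \subset R)].
Proof. by apply/subsetP=> R; rewrite !inE => /and3P [-> ->]. Qed.

Lemma shadow_le k x S : #|shadow k x S| <= deg F k [set x].
Proof. exact/subset_leq_card/shadow_sub. Qed.

(** Distinct sets of size [k.+1] meet in at most [k] points, so a common [k]-subset must be
    [S :&: S'] itself. *)
Lemma card_shadowI k x S S' : #|S| = k.+1 -> #|S'| = k.+1 -> S != S' ->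
  #|shadow k x S :&: shadow k x S'| <= 1.
Proof.
move=> cS cS' nSS'; rewrite -(cards1 (S :&: S')).
apply/subset_leq_card/subsetP=> R; rewrite !inE.
case/andP=> /and3P [_ /andP [/eqP cR _] RS] /and3P [_ _ RS'].
rewrite eqEcard subsetI RS RS' cR /= -ltnS -cS.
apply: proper_card; rewrite properEneq subsetIl andbT.
by apply: contra nSS' => /eqP/setIidPl sSS'; rewrite eqEcard sSS' cS cS' /=.
Qed.

(** First of three small cases of Kruskal-Katona in the link graph: 1, 2 or 3 triangles need at
    least 3, 5 or 6 edges, because two triangles share at most one edge. *)
Lemma c_gt0_b x : 0 < c x -> 3 <= b x.
Proof.
case/card_gt0P=> S; rewrite !inE sub1set => /and3P [SF /eqP cS xS].
exact: leq_trans (card_shadow SF cS xS) (shadow_le _ _ _).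
Qed.

Lemma c_gt1_b x : 1 < c x -> 5 <= b x.
Proof.
case/card_gt1P=> S [S' []]; rewrite !inE !sub1set.
move=> /and3P [SF /eqP cS xS] /and3P [SF' /eqP cS' xS'] nSS'.
have := card_shadow SF cS xS; have := card_shadow SF' cS' xS'.
have := card_shadowI x cS cS' nSS'.
have : #|shadow 3 x S :|: shadow 3 x S'| <= b x.
  by apply/subset_leq_card; rewrite subUset !shadow_sub.
rewrite cardsU; lia.
Qed.

Lemma c_gt2_b x : 2 < c x -> 6 <= b x.
Proof.
case/card_gt2P=> S [S' [S'' [[]]]]; rewrite !inE !sub1set.
move=> /and3P [SF /eqP cS xS] /and3P [SF' /eqP cS' xS'].
move=> /and3P [SF'' /eqP cS'' xS''] [n1 n2 n3].
have := card_shadow SF cS xS; have := card_shadow SF' cS' xS'.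
have := card_shadow SF'' cS'' xS''.
have := card_shadowI x cS cS' n1; have := card_shadowI x cS' cS'' n2.
have := card_shadowI x cS'' cS n3.
have : #|shadow 3 x S :|: shadow 3 x S' :|: shadow 3 x S''| <= b x.
  by apply/subset_leq_card; rewrite !subUset !shadow_sub.
rewrite !cardsU setIUl cardsU [shadow 3 x S'' :&: _]setIC.
have := cardsUI (shadow 3 x S) (shadow 3 x S').
have := cardsUI (shadow 3 x S :&: shadow 3 x S'') (shadow 3 x S' :&: shadow 3 x S'').
lia.
Qed.

(** The numerical facts used by the final arithmetic. With at most three neighbours the total is at
    most 3 + 3 + 1, so a total of 11 forces four neighbours. *)
Lemma link_bounds x :
  [/\ a x <= 3 -> a x + b x + c x <= 7, a x = 4 -> b x <= 6,
      0 < c x -> 3 <= b x, 1 < c x -> 5 <= b x & 2 < c x -> 6 <= b x].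
Proof.
split; [| |exact: c_gt0_b|exact: c_gt1_b|exact: c_gt2_b].
  have := deg1_bin 2 x her; have := deg1_bin 3 x her.
  by move=> + + /[dup] a3 /small_bin/andP []; lia.
by move=> a4; have := deg1_bin 2 x her; rewrite a4.
Qed.

Lemma a_ge4 x : 6 <= b x -> 4 <= a x.
Proof.
have := deg1_bin 2 x her => bb b6; rewrite ltnNge.
by apply/negP => /small_bin/andP []; lia.
Qed.

Lemma link_sum k x : \sum_(y in N x) deg F k.+1 [set x; y] = k * deg F k.+1 [set x].
Proof.
have := deg_sum F k.+1 [set x]; rewrite cards1 subn1 /= => <-.
rewrite [RHS](bigID (mem (N x))) /= [X in _ + X]big1 ?addn0.
  apply: eq_big => y; first by rewrite !inE; case: eqVneq.
  by rewrite setUC.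
move=> y; rewrite !inE => /andP [-> /= yF].
by rewrite deg_eq0 // setUC.
Qed.

Lemma p_card x y : y != x ->
  p x y = #|[set z | (z \notin [set x; y]) && ([set x; y; z] \in F)]|.
Proof.
move=> nyx; have := deg_sum F 3 [set x; y].
rewrite cards2 eq_sym nyx mul1n => <-.
rewrite -sum1_card [LHS](bigID (fun z => [set x; y; z] \in F)) /= [X in _ + X]big1 ?addn0.
  apply: eq_big => z; first by rewrite [RHS]inE.
  case/andP => zxy zF.
  have -> : 3 = #|z |: [set x; y]| by rewrite cardsU1 zxy cards2 eq_sym nyx.
  by rewrite deg_self setUC zF.
by move=> z /andP [_ zF]; rewrite deg_eq0 // setUC.
Qed.

(** Form of [deg_sum] for an explicit list [ns] that covers all neighbours of [x] outside [A]; the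
    other terms vanish by heredity. *)
Lemma deg_link_sum k A x ns : x \in A -> uniq ns -> {in ns, forall z, z \notin A} ->
  {subset N x <= [predU A & ns]} ->
  \sum_(z <- ns) deg F k (A :|: [set z]) = (k - #|A|) * deg F k A.
Proof.
move=> xA uns nsA Nns; rewrite -deg_sum big_uniq //=.
rewrite [RHS](bigID (mem ns)) /= [X in _ + X]big1 ?addn0.
  apply: eq_big => z; last by rewrite setUC.
  by have [/nsA ->|] := boolP (z \in ns); rewrite ?andbF.
move=> z /andP [zA zns]; apply: deg_eq0 => //; apply/negP => zF.
have /Nns : z \in N x.
  apply: nbhd_sub zF _ _ _; rewrite ?inE ?xA ?eqxx ?orbT //.
  by apply: contraNneq zA => ->.
by rewrite inE /= (negbTE zA) (negbTE zns).
Qed.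

End Link.

(** * Points of weight below 318 *)

Section FourNeighbours.

Variables (V : finType) (F : {set {set V}}).
Hypothesis her : hereditary F.
Implicit Types (A B C S : {set V}) (x y z u v w : V).

Local Notation a x := (deg F 2 [set x]).
Local Notation b x := (deg F 3 [set x]).
Local Notation c x := (deg F 4 [set x]).
Local Notation p x y := (deg F 3 [set x; y]).
Local Notation q x y := (deg F 4 [set x; y]).
Local Notation N := (nbhd F).

Lemma card_set3 x y z : uniq [:: x; y; z] -> #|[set x; y; z]| = 3.
Proof.
rewrite /= !inE negb_or => /and3P [/andP [xy xz] yz _].
by rewrite setUC cardsU1 cards2 !inE xy negb_or ![z == _]eq_sym xz yz.
Qed.

Lemma card_set4 x y z w : uniq [:: x; y; z; w] -> #|[set x; y; z; w]| = 4.
Proof.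
move=> u; rewrite setUC cardsU1 card_set3; last first.
  by move: u; rewrite -[[:: x; y; z; w]]/(rcons [:: x; y; z] w) rcons_uniq => /andP [].
move: u; rewrite -[[:: x; y; z; w]]/(rcons [:: x; y; z] w) rcons_uniq !inE orbA.
by case/andP => ->.
Qed.

Lemma set4_rot x y z w : [set x; y; z; w] = [set x; z; w; y].
Proof. by apply/setP => s; rewrite !inE; case: (s == x); case: (s == y); case: (s == z); case: (s == w). Qed.

Section Neighbourhood4.

Variables (x y z1 z2 z3 : V).
Hypothesis Nx : N x =i [:: y; z1; z2; z3].
Hypothesis uN : uniq [:: y; z1; z2; z3].

Lemma uniq_x_nbhd : uniq [:: x; y; z1; z2; z3].
Proof. by rewrite cons_uniq uN andbT -Nx inE eqxx. Qed.

Lemma p_nbhd4 :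
  p x y = ([set x; y; z1] \in F) + ([set x; y; z2] \in F) + ([set x; y; z3] \in F).
Proof.
have ux := uniq_x_nbhd; move: (ux); rewrite /= !inE !negb_or -!andbA.
case/and5P=> xy x1 x2 x3 /and5P [y1 y2 y3 n12 /and3P [n13 n23 _]].
have := @deg_link_sum _ _ her 3 [set x; y] x [:: z1; z2; z3].
rewrite !big_cons big_nil addn0 cards2 xy mul1n => <- //.
- have E z : x != z -> y != z -> deg F 3 ([set x; y] :|: [set z]) = ([set x; y; z] \in F).
    by move=> xz yz; rewrite -[3](@card_set3 x y z) ?deg_self //= !inE negb_or xy xz yz.
  by rewrite !E // addnA.
- by rewrite !inE eqxx.
- by case/andP: uN.
- by move=> z; rewrite !inE negb_or => /or3P [] /eqP ->; rewrite eq_sym ?x1 ?x2 ?x3 eq_sym ?y1 ?y2 ?y3.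
- by move=> z; rewrite Nx !inE => /orP [->|->]; rewrite ?orbT.
Qed.

Lemma q_nbhd4 :
  q x y = ([set x; y; z1; z2] \in F) + ([set x; y; z1; z3] \in F)
        + ([set x; y; z2; z3] \in F).
Proof.
have ux := uniq_x_nbhd; move: (ux); rewrite /= !inE !negb_or -!andbA.
case/and5P=> xy x1 x2 x3 /and5P [y1 y2 y3 n12 /and3P [n13 n23 _]].
have R z s t : uniq [:: x; y; z; s] -> uniq [:: x; y; z; t] -> s != t ->
    N x =i [:: y; z; s; t] ->
    deg F 4 [set x; y; z] = ([set x; y; z; s] \in F) + ([set x; y; z; t] \in F).
  move=> us ut st Ns.
  have ux3 : uniq [:: x; y; z].
    by move: us; rewrite -[_ :: _]/(rcons [:: x; y; z] s) rcons_uniq => /andP [].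
  have := @deg_link_sum _ _ her 4 [set x; y; z] x [:: s; t].
  rewrite !big_cons big_nil addn0 card_set3 // mul1n => H.
  rewrite -{}H.
  - by rewrite -{1}(card_set4 us) deg_self -(card_set4 ut) deg_self.
  - by rewrite !inE eqxx.
  - by rewrite /= inE st.
  - move=> r; rewrite !inE => /orP [] /eqP ->.
      by move: us; rewrite -[_ :: _]/(rcons [:: x; y; z] s) rcons_uniq !inE orbA => /andP [].
    by move: ut; rewrite -[_ :: _]/(rcons [:: x; y; z] t) rcons_uniq !inE orbA => /andP [].
  - by move=> r; rewrite Ns !inE => /or4P [] ->; rewrite ?orbT.
(* Each 4-set through [x] and [y] is counted once for each of its two other points, which gives the
   factor 2. *)
have := @deg_link_sum _ _ her 4 [set x; y] x [:: z1; z2; z3].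
rewrite !big_cons big_nil addn0 cards2 xy => H.
have {H} : deg F 4 [set x; y; z1] + (deg F 4 [set x; y; z2] + deg F 4 [set x; y; z3]) = 2 * q x y.
  apply: H.
  - by rewrite !inE eqxx.
  - by case/andP: uN.
  - by move=> z; rewrite !inE negb_or => /or3P [] /eqP ->; rewrite eq_sym ?x1 ?x2 ?x3 eq_sym ?y1 ?y2 ?y3.
  - by move=> z; rewrite Nx !inE => /orP [->|->]; rewrite ?orbT.
rewrite (@R z1 z2 z3) ?(@R z2 z1 z3) ?(@R z3 z1 z2) //.
all: rewrite ?[[set x; y; z2; z1]]setUAC ?[[set x; y; z3; z1]]setUAC ?[[set x; y; z3; z2]]setUAC.
all: try by rewrite /= !inE !negb_or ?xy ?x1 ?x2 ?x3 ?y1 ?y2 ?y3 ?n12 ?n13 ?n23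
  1?eq_sym ?n12 ?n13 ?n23.
- by move: (nat_of_bool _) (nat_of_bool _) (nat_of_bool _) => i j k; lia.
- by move=> r; rewrite Nx !inE; case: (r == y); case: (r == z1); case: (r == z2); case: (r == z3).
- by move=> r; rewrite Nx !inE; case: (r == y); case: (r == z1); case: (r == z2); case: (r == z3).
Qed.

End Neighbourhood4.

(** Expresses every count by the six possible edges [e] and four possible triangles [t] of the link,
    so that the classification of low points becomes a case analysis on booleans. *)
Lemma link4 x n1 n2 n3 n4 : N x =i [:: n1; n2; n3; n4] -> uniq [:: n1; n2; n3; n4] ->
  let e y z := nat_of_bool ([set x; y; z] \in F) in
  let t y z w := nat_of_bool ([set x; y; z; w] \in F) in
  [/\ b x = e n1 n2 + e n1 n3 + e n1 n4 + e n2 n3 + e n2 n4 + e n3 n4,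
      c x = t n1 n2 n3 + t n1 n2 n4 + t n1 n3 n4 + t n2 n3 n4,
      [/\ p x n1 = e n1 n2 + e n1 n3 + e n1 n4, p x n2 = e n1 n2 + e n2 n3 + e n2 n4,
          p x n3 = e n1 n3 + e n2 n3 + e n3 n4 & p x n4 = e n1 n4 + e n2 n4 + e n3 n4] &
      [/\ q x n1 = t n1 n2 n3 + t n1 n2 n4 + t n1 n3 n4,
          q x n2 = t n1 n2 n3 + t n1 n2 n4 + t n2 n3 n4,
          q x n3 = t n1 n2 n3 + t n1 n3 n4 + t n2 n3 n4 &
          q x n4 = t n1 n2 n4 + t n1 n3 n4 + t n2 n3 n4]].
Proof.
move=> Nx uN e t.
have eC y z : e y z = e z y by rewrite /e setUAC.
have tC y z w : t y z w = t z y w by rewrite /t (setUAC [set x]).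
have tR y z w : t y z w = t z w y by rewrite /t set4_rot.
have N2 : N x =i [:: n2; n1; n3; n4].
  by move=> r; rewrite Nx; apply: perm_mem; rewrite (perm_catCA [:: n1] [:: n2]).
have N3 : N x =i [:: n3; n1; n2; n4].
  by move=> r; rewrite Nx; apply: perm_mem; rewrite (perm_catCA [:: n1; n2] [:: n3]).
have N4 : N x =i [:: n4; n1; n2; n3].
  by move=> r; rewrite Nx; apply: perm_mem; rewrite (perm_catC [:: n1; n2; n3] [:: n4]).
have u2 : uniq [:: n2; n1; n3; n4] by rewrite (perm_uniq (permEl (perm_catCA [:: n2] [:: n1] _))).
have u3 : uniq [:: n3; n1; n2; n4] by rewrite (perm_uniq (permEl (perm_catCA [:: n3] [:: n1; n2] _))).
have u4 : uniq [:: n4; n1; n2; n3].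
  by rewrite (perm_uniq (permEl (perm_catC [:: n4] [:: n1; n2; n3]))).
have := p_nbhd4 Nx uN; have := p_nbhd4 N2 u2; have := p_nbhd4 N3 u3; have := p_nbhd4 N4 u4.
have := q_nbhd4 Nx uN; have := q_nbhd4 N2 u2; have := q_nbhd4 N3 u3; have := q_nbhd4 N4 u4.
rewrite -/(e _ _) -!/(t _ _ _) -!/(e _ _).
have sumN (f : V -> nat) : \sum_(y in N x) f y = f n1 + f n2 + f n3 + f n4.
  rewrite (eq_bigl (mem [:: n1; n2; n3; n4])); last exact: Nx.
  by rewrite -big_uniq //= !big_cons big_nil addn0 !addnA.
(* The values of [b] and [c] follow from those of [p] and [q]: a link edge has two ends and a link
   triangle three vertices. *)
have sp := link_sum her 2 x; have sq := link_sum her 3 x; rewrite !sumN in sp sq.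
rewrite (eC n2 n1) (eC n3 n1) (eC n3 n2) (eC n4 n1) (eC n4 n2) (eC n4 n3).
rewrite (tC n2 n1) (tR n3 n1 n2) (tC n2 n1) (tC n3 n1) (tC n3 n2).
rewrite (tR n4 n1 n2) (tR n4 n1 n3) (tR n4 n2 n3).
move=> q4 q3 q2 q1 p4 p3 p2 p1; rewrite p1 p2 p3 p4 in sp *; rewrite q1 q2 q3 q4 in sq *.
by clearbody e t; split=> //; lia.
Qed.

End FourNeighbours.

(** * Links of the two low types, and low tips *)

Section LowPoints.

Variables (V : finType) (F : {set {set V}}).
Hypothesis her : hereditary F.
Implicit Types (A B C S : {set V}) (x y z u v w : V).

Local Notation a x := (deg F 2 [set x]).
Local Notation b x := (deg F 3 [set x]).
Local Notation c x := (deg F 4 [set x]).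
Local Notation p x y := (deg F 3 [set x; y]).
Local Notation q x y := (deg F 4 [set x; y]).
Local Notation N := (nbhd F).

Definition typeA x := [&& a x == 4, b x == 5 & c x == 2].
Definition typeB x := [&& a x == 4, b x == 6 & c x == 1].
Definition low x := typeA x || typeB x.

Lemma pC x y : p x y = p y x. Proof. by rewrite setUC. Qed.
Lemma qC x y : q x y = q y x. Proof. by rewrite setUC. Qed.

Lemma nbhd4 x : a x = 4 -> exists n1 n2 n3 n4,
  uniq [:: n1; n2; n3; n4] /\ N x =i [:: n1; n2; n3; n4].
Proof.
move=> a4; have : size (enum (N x)) = 4 by rewrite -cardE card_nbhd.
have := enum_uniq (N x); have : N x =i enum (N x) by move=> y; rewrite mem_enum.
case: (enum (N x)) => [|n1 [|n2 [|n3 [|n4 [|]]]]] // eN uN _.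
by exists n1, n2, n3, n4.
Qed.

(* The link graph of a type A point is [K_4] minus the edge [v1 v2], with both triangles
   filled: [u1], [u2] are called its bases and [v1], [v2] its tips. *)
Definition structA x u1 u2 v1 v2 :=
  [/\ uniq [:: u1; u2; v1; v2] /\ N x =i [:: u1; u2; v1; v2],
      [/\ p x u1 = 3, p x u2 = 3, p x v1 = 2 & p x v2 = 2],
      [/\ q x u1 = 2, q x u2 = 2, q x v1 = 1 & q x v2 = 1],
      [/\ [set x; u1; u2; v1] \in F & [set x; u1; u2; v2] \in F] &
      [set x; v1; v2] \notin F].

Lemma set3_sub4 x y z w : [set x; y; z; w] \in F ->
  [/\ [set x; y; z] \in F, [set x; y; w] \in F & [set x; z; w] \in F].
Proof.
by move=> S4; split; apply: hereditary_sub her S4 _; apply/subsetP => s;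
  rewrite !inE -!orbA => /or3P [] /eqP ->; rewrite eqxx ?orbT.
Qed.

(** The missing edge [v1 v2] rules out two of the four triangles; the values 5 and 2 then force all
    other edges and triangles to be present. *)
Lemma structA_of x u1 u2 v1 v2 : typeA x ->
  uniq [:: u1; u2; v1; v2] -> N x =i [:: u1; u2; v1; v2] ->
  [set x; v1; v2] \notin F -> structA x u1 u2 v1 v2.
Proof.
case/and3P=> _ /eqP b5 /eqP c2 uN Nx nv.
have /= := link4 her Nx uN; rewrite b5 c2 (negbTE nv) => -[].
have n1 : [set x; u1; v1; v2] \notin F by apply: contra nv => /set3_sub4 [].
have n2 : [set x; u2; v1; v2] \notin F by apply: contra nv => /set3_sub4 [].
rewrite (negbTE n1) (negbTE n2) /structA.
do 5!case: (_ \in F) => //=.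
by case: (_ \in F) => //=; case: (_ \in F) => //= _ _ [-> -> -> ->] [-> -> -> ->].
Qed.

(** Exactly one of the six possible link edges is missing; its ends are taken as tips. *)
Lemma typeA_struct x : typeA x -> exists u1 u2 v1 v2, structA x u1 u2 v1 v2.
Proof.
move=> Ax; have /and3P [/eqP a4 /eqP b5 _] := Ax.
have [n1 [n2 [n3 [n4 [uN Nx]]]]] := nbhd4 a4.
have P s : perm_eq s [:: n1; n2; n3; n4] -> uniq s /\ N x =i s.
  by move=> ps; rewrite (perm_uniq ps); split=> // r; rewrite Nx (perm_mem ps).
have [/= + _ _ _] := link4 her Nx uN; rewrite b5.
have [h|h _] := boolP ([set x; n3; n4] \in F); last first.
  by exists n1, n2, n3, n4; apply: structA_of.
have [h2|h2 _] := boolP ([set x; n2; n4] \in F); last first.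
  have [|u' N'] := P [:: n1; n3; n2; n4].
    by rewrite perm_cons (permEl (perm_catCA [:: n3] [:: n2] _)).
  by exists n1, n3, n2, n4; apply: structA_of.
have [h3|h3 _] := boolP ([set x; n2; n3] \in F); last first.
  have [|u' N'] := P [:: n1; n4; n2; n3].
    by rewrite perm_cons (permEl (perm_catC [:: n4] [:: n2; n3])).
  by exists n1, n4, n2, n3; apply: structA_of.
have [h4|h4 _] := boolP ([set x; n1; n4] \in F); last first.
  have [|u' N'] := P [:: n2; n3; n1; n4].
    by rewrite (permEl (perm_catCA [:: n2; n3] [:: n1] _)).
  by exists n2, n3, n1, n4; apply: structA_of.
have [h5|h5 _] := boolP ([set x; n1; n3] \in F); last first.
  have [|u' N'] := P [:: n2; n4; n1; n3].
    apply: (perm_trans (permEl (perm_catCA [:: n2; n4] [:: n1] [:: n3]))).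
    by rewrite /= !perm_cons (permEl (perm_catC [:: n4] [:: n3])).
  by exists n2, n4, n1, n3; apply: structA_of.
have [h6|h6 _] := boolP ([set x; n1; n2] \in F); last first.
  have [|u' N'] := P [:: n3; n4; n1; n2].
    by rewrite (permEl (perm_catC [:: n3; n4] [:: n1; n2])).
  by exists n3, n4, n1, n2; apply: structA_of.
by [].
Qed.

(* The link graph of a type B point is [K_4], with only the triangle of the bases [u1],
   [u2], [u3] filled; [v] is its tip. *)
Definition structB x u1 u2 u3 v :=
  [/\ uniq [:: u1; u2; u3; v] /\ N x =i [:: u1; u2; u3; v],
      [/\ p x u1 = 3, p x u2 = 3, p x u3 = 3 & p x v = 3],
      [/\ q x u1 = 1, q x u2 = 1, q x u3 = 1 & q x v = 0] &
      [/\ [set x; u1; v] \in F, [set x; u2; v] \in F & [set x; u3; v] \in F]].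

Lemma structB_of x u1 u2 u3 v : typeB x ->
  uniq [:: u1; u2; u3; v] -> N x =i [:: u1; u2; u3; v] ->
  [set x; u1; u2; u3] \in F -> structB x u1 u2 u3 v.
Proof.
case/and3P=> _ /eqP b6 /eqP c1 uN Nx t.
have /= := link4 her Nx uN; rewrite b6 c1 t => -[].
rewrite /structB.
do 6!case: (_ \in F) => //=.
by do 3!case: (_ \in F) => //=; move=> _ _ [-> -> -> ->] [-> -> -> ->].
Qed.

Lemma typeB_struct x : typeB x -> exists u1 u2 u3 v, structB x u1 u2 u3 v.
Proof.
move=> Bx; have /and3P [/eqP a4 _ /eqP c1] := Bx.
have [n1 [n2 [n3 [n4 [uN Nx]]]]] := nbhd4 a4.
have P s : perm_eq s [:: n1; n2; n3; n4] -> uniq s /\ N x =i s.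
  by move=> ps; rewrite (perm_uniq ps); split=> // r; rewrite Nx (perm_mem ps).
have [/= _ + _ _] := link4 her Nx uN; rewrite c1.
have [h _|h] := boolP ([set x; n1; n2; n3] \in F).
  by exists n1, n2, n3, n4; apply: structB_of.
have [h2 _|h2] := boolP ([set x; n1; n2; n4] \in F).
  have [|u' N'] := P [:: n1; n2; n4; n3].
    by rewrite !perm_cons (permEl (perm_catC [:: n4] [:: n3])).
  by exists n1, n2, n4, n3; apply: structB_of.
have [h3 _|h3] := boolP ([set x; n1; n3; n4] \in F).
  have [|u' N'] := P [:: n1; n3; n4; n2].
    by rewrite perm_cons (permEl (perm_catC [:: n3; n4] [:: n2])).
  by exists n1, n3, n4, n2; apply: structB_of.
have [h4 _|h4] := boolP ([set x; n2; n3; n4] \in F).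
  have [|u' N'] := P [:: n2; n3; n4; n1].
    by rewrite (permEl (perm_catC [:: n2; n3; n4] [:: n1])).
  by exists n2, n3, n4, n1; apply: structB_of.
by [].
Qed.

(** The first alternative is a base, the second a tip, so [q] alone tells the role of a
    neighbour. *)
Lemma typeA_nbr x y : typeA x -> y \in N x ->
  (p x y = 3 /\ q x y = 2) \/ (p x y = 2 /\ q x y = 1).
Proof.
case/typeA_struct=> u1 [u2 [v1 [v2 [[_ ->] [p1 p2 p3 p4] [q1 q2 q3 q4] _ _]]]].
by rewrite !inE => /or4P [] /eqP ->; [left|left|right|right].
Qed.

(** Here [q] is 1 at a base and 0 at the tip. *)
Lemma typeB_nbr x y : typeB x -> y \in N x ->
  p x y = 3 /\ (q x y = 1 \/ q x y = 0).
Proof.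
case/typeB_struct=> u1 [u2 [u3 [v [[_ ->] [p1 p2 p3 p4] [q1 q2 q3 q4] _]]]].
by rewrite !inE => /or4P [] /eqP ->; split=> //; [left|left|left|right].
Qed.

Lemma typeAB x : typeA x -> typeB x = false.
Proof. by rewrite /typeA /typeB => /and3P [_ /eqP -> _]; rewrite andbF. Qed.

Lemma low_c x : low x -> c x <= 2.
Proof. by case/orP => /and3P [_ _ /eqP ->]. Qed.

Lemma typeA_base x y z : typeA x -> y \in N x -> q x y = 1 ->
  z != x -> z != y -> [set x; y; z] \in F -> q x z = 2.
Proof.
case/typeA_struct=> u1 [u2 [v1 [v2 [[uN Nx] _ [q1 q2 q3 q4] _ nv]]]].
move=> yN qy zx zy xyz.
have zN : z \in N x by apply: (nbhd_sub her xyz); rewrite // !inE eqxx ?orbT.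
move: yN zN; rewrite !Nx !inE => /or4P [] /eqP yE; rewrite yE ?q1 ?q2 // in qy;
  case/or4P => /eqP zE; rewrite zE // in zy xyz *.
- by rewrite yE eqxx in zy.
- by rewrite yE (negbTE nv) in xyz.
- by rewrite yE setUAC (negbTE nv) in xyz.
- by rewrite yE eqxx in zy.
Qed.

Lemma typeA_triple x y z : typeA x -> y \in N x -> z \in N x ->
  q x y = 1 -> q x z = 2 -> [set x; y; z] \in F.
Proof.
case/typeA_struct=> u1 [u2 [v1 [v2 [[uN Nx] _ [q1 q2 q3 q4] [s1 s2] nv]]]].
have [t1 t2 t3] := set3_sub4 s1; have [r1 r2 r3] := set3_sub4 s2.
rewrite !Nx !inE => /or4P [] /eqP ->; rewrite ?q1 ?q2 // => /or4P [] /eqP ->;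
  rewrite ?q3 ?q4 //= ?t1 ?t2 ?t3 ?r1 ?r2 ?r3 //; by rewrite setUAC.
Qed.

Lemma c_ge u x v : q u x + q u v <= c u + q x v.
Proof.
have := @deg_incl _ F 4 [set u] [set u; x] [set u; v].
have : deg F 4 ([set u; x] :|: [set u; v]) <= q x v.
  by apply: deg_subset; rewrite subUset !sub1set !inE !eqxx ?orbT.
by move=> h1 h2; have := h2 (subsetUl _ _) (subsetUl _ _); lia.
Qed.

(** As [p x v] is 2, a low [v] has type A and [x] is a tip of it. Then [u] is a base of both, and
    [c_ge] yields at least 2 + 2 - 1 = 3 4-sets through [u], too many for a low point. *)
Lemma typeA_low_tip x v u : typeA x -> v \in N x -> q x v = 1 -> low v ->
  u \in N x -> q x u = 2 -> ~~ low u.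
Proof.
move=> Ax vN qv lv uN qu.
have xvu := typeA_triple Ax vN uN qv qu.
have nux : u != x by move: uN; rewrite mem_nbhd => /andP [].
have nvx : v != x by move: vN; rewrite mem_nbhd => /andP [].
have nuv : u != v by apply: contraPneq qu => ->; rewrite qv.
have xN : x \in N v by rewrite nbhdC.
have pv : p v x = 2 by rewrite pC; case: (typeA_nbr Ax vN) => -[]; rewrite ?qv.
have Av : typeA v by case/orP: lv => // Bv; have [] := typeB_nbr Bv xN; rewrite pv.
have qvu : q v u = 2.
  apply: (typeA_base Av xN) => //; first by rewrite qC.
  by rewrite (setUC [set v]).
apply/negP => /low_c; have := c_ge u x v.
by rewrite qC qu [q u v]qC qvu qv; lia.
Qed.

(** As [q x v] is 0, a low [v] has type B with tip [x], and [u] is a base of both. So [c u] is at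
    least 2, which excludes type B; type A is excluded because [p u x] is 3 while [q u x] is 1. *)
Lemma typeB_low_tip x v u : typeB x -> v \in N x -> q x v = 0 -> low v ->
  u \in N x -> q x u = 1 -> ~~ low u.
Proof.
move=> Bx vN qv lv uN qu; have xN : x \in N v by rewrite nbhdC.
have nuv : u != v by apply: contraPneq qu => ->; rewrite qv.
have nux : u != x by move: uN; rewrite mem_nbhd => /andP [].
have xvu : [set x; v; u] \in F.
  move: vN uN qv qu; have := typeB_struct Bx.
  case=> u1 [u2 [u3 [w [[_ Nx] _ [q1 q2 q3 q4] [s1 s2 s3]]]]].
  rewrite !Nx !inE => /or4P [] /eqP ->; rewrite ?q1 ?q2 ?q3 // => /or4P [] /eqP ->;
  by rewrite ?q4 // => _ _; rewrite setUAC.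
have Bv : typeB v.
  case/orP: lv => // Av; case: (typeA_nbr Av xN) => -[_]; by rewrite qC qv.
have uNv : u \in N v by apply: (nbhd_sub her xvu); rewrite // !inE eqxx ?orbT.
have qvu : q v u = 1.
  rewrite qC in qv; move: xN uNv nux qv; have := typeB_struct Bv.
  case=> u1 [u2 [u3 [w [[_ Nx] _ [q1 q2 q3 q4] _]]]].
  rewrite !Nx !inE => /or4P [] /eqP ->; rewrite ?q1 ?q2 ?q3 // => /or4P [] /eqP ->;
  by rewrite ?eqxx.
have cu : 2 <= c u by have := c_ge u x v; rewrite qC qu [q u v]qC qvu qv; lia.
apply/negP => /orP [Au|/and3P [_ _ /eqP c1]]; last by rewrite c1 in cu.
have xNu : x \in N u by rewrite nbhdC.
have [px _] := typeB_nbr Bx uN.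
by case: (typeA_nbr Au xNu) => -[]; rewrite ?[p u x]pC ?px // qC qu.
Qed.

End LowPoints.

(** * Tips of type A points whose bases are both low *)

Section Tips.

Variables (V : finType) (F : {set {set V}}).
Hypothesis her : hereditary F.
Implicit Types (A B C S : {set V}) (x y z u v w : V).

Local Notation a x := (deg F 2 [set x]).
Local Notation b x := (deg F 3 [set x]).
Local Notation c x := (deg F 4 [set x]).
Local Notation p x y := (deg F 3 [set x; y]).
Local Notation q x y := (deg F 4 [set x; y]).
Local Notation N := (nbhd F).
Local Notation typeA := (typeA F).
Local Notation typeB := (typeB F).
Local Notation low := (low F).

Lemma typeA_bases x v : typeA x -> v \in N x -> q x v = 1 ->
  exists u1 u2, [/\ u1 != u2, u1 \in N x /\ u2 \in N x,
    q x u1 = 2 /\ q x u2 = 2 & [set x; u1; u2; v] \in F].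
Proof.
case/(typeA_struct her)=> u1 [u2 [v1 [v2 [[uN Nx] _ [q1 q2 q3 q4] [s1 s2] nv]]]].
move=> vN qv; exists u1, u2; split=> //.
- by case/andP: uN; rewrite inE negb_or => /andP [].
- by rewrite !Nx !inE !eqxx ?orbT.
- by move: vN qv; rewrite Nx !inE => /or4P [] /eqP ->; rewrite ?q1 ?q2.
Qed.

Lemma p2_closed v w s s' z : p v w = 2 -> w != v -> s != s' ->
  s \notin [set v; w] -> s' \notin [set v; w] -> z \notin [set v; w] ->
  [set v; w; s] \in F -> [set v; w; s'] \in F -> [set v; w; z] \in F ->
  z \in [set s; s'].
Proof.
move=> p2 wv ss' sn s'n zn sF s'F zF; apply: contraT => znss.
suff : 3 <= p v w by rewrite p2.
rewrite (p_card her wv); apply: leq_trans (_ : #|z |: [set s; s']| <= _).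
  by rewrite cardsU1 znss cards2 ss'.
apply/subset_leq_card/subsetP=> r; rewrite in_setU1 in_set2 inE.
by case/or3P => /eqP ->; rewrite ?zn ?sn ?s'n.
Qed.

Hypothesis deg_ge : forall x, 11 <= a x + b x + c x.

(* The three vertices [x], [u1], [u2] form a component of the link graph of [v]. *)
Lemma typeA_tip_large x v : typeA x -> v \in N x -> q x v = 1 ->
  (forall u, u \in N x -> q x u = 2 -> low u) -> 6 <= a v.
Proof.
move=> Ax vN qv lowb.
have [u1 [u2 [nu [uN1 uN2] [q1 q2] SF]]] := typeA_bases Ax vN qv.
(* A low base has type A, since its [q] value 2 does not occur in type B. If [v] were a base of [u],
   then [c_ge] would give [c u] at least 3; so [v] is a tip of [u]. *)
have base u : u \in N x -> q x u = 2 -> p u v = 2.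
  move=> uN qu; have xN : x \in N u by rewrite nbhdC.
  have Au : typeA u.
    case/orP: (lowb u uN qu) => // Bu.
    by have [_] := typeB_nbr her Bu xN; rewrite qC qu => -[].
  have vNu : v \in N u.
    have := typeA_triple her Ax vN uN qv qu => xvu.
    apply: (nbhd_sub her xvu); rewrite ?inE ?eqxx ?orbT //.
    by apply: contraPneq qu => <-; rewrite qv.
  have [[_ quv]|[]//] := typeA_nbr her Au vNu.
  have := @c_ge _ F u x v; have /and3P [_ _ /eqP ->] := Au.
  by rewrite quv qv qC qu.
have px : p v x = 2 by rewrite pC; case: (typeA_nbr her Ax vN) => -[]; rewrite ?qv.
have p1 : p v u1 = 2 by rewrite pC base.
have p2 : p v u2 = 2 by rewrite pC base.
have nvx : v != x by move: vN; rewrite mem_nbhd => /andP [].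
have n1x : u1 != x by move: uN1; rewrite mem_nbhd => /andP [].
have n2x : u2 != x by move: uN2; rewrite mem_nbhd => /andP [].
have n1v : u1 != v by apply: contraPneq q1 => ->; rewrite qv.
have n2v : u2 != v by apply: contraPneq q2 => ->; rewrite qv.
have sub s t : s \in [set x; u1; u2] -> t \in [set x; u1; u2] -> [set v; s; t] \in F.
  move=> sK tK; apply: hereditary_sub her SF _; rewrite !subUset !sub1set.
  by move: sK tK; rewrite !inE => /orP [/orP [] | ] -> /orP [/orP [] | ] ->; rewrite eqxx ?orbT.
set K := [set x; u1; u2] in sub *.
have cK : #|K| = 3 by apply: card_set3; rewrite /= !inE negb_or eq_sym n1x eq_sym n2x nu.
have vK : v \notin K by rewrite !inE !negb_or nvx ![v == _]eq_sym n1v n2v.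
have KN w : w \in K -> w \in N v.
  move=> wK; apply: (nbhd_sub her (sub w w wK wK)); rewrite ?inE ?eqxx ?orbT //.
  by apply: contraNneq vK => <-.
have pK w : w \in K -> p v w = 2 by rewrite !inE => /orP [/orP [] | ] /eqP ->.
(* Both link neighbours of [w] are the other two points of [K], as [p v w] is 2. *)
have closed w z : w \in K -> z \notin K -> z != v -> [set v; w; z] \notin F.
  move=> wK zK zv; apply/negP => zF.
  have wv : w != v by apply: contraNneq vK => <-.
  have : 1 < #|K :\ w| by move: cK; rewrite (cardsD1 w) wK add1n => -[->].
  case/card_gt1P=> s [t []]; rewrite !inE -/K => /andP [sw sK'] /andP [tw tK'] st.
  have sK : s \in K by rewrite !inE.
  have tK : t \in K by rewrite !inE.
  have out r : r \in K -> r != w -> r \notin [set v; w].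
    move=> rK rw; rewrite !inE negb_or rw andbT.
    by apply: contraNneq vK => <-.
  have znw : z \notin [set v; w].
    by rewrite !inE negb_or zv; apply: contraNneq zK => ->.
  have := @p2_closed v w s t z (pK w wK) wv st (out s sK sw) (out t tK tw) znw
    (sub w s wK sK) (sub w t wK tK) zF.
  by rewrite !inE => /orP [] /eqP E; rewrite E ?sK ?tK in zK.
(* In the link of [v], a vertex outside [K] is adjacent neither to itself nor to the three points of
   [K]. *)
have pout y : y \in N v -> y \notin K -> p v y <= a v - 4.
  move=> yN yK; have yv : y != v by move: yN; rewrite mem_nbhd => /andP [].
  rewrite (p_card her yv).
  have <- : #|N v :\: (y |: K)| = a v - 4.
    rewrite cardsD (setIidPr _) ?card_nbhd ?cardsU1 ?yK ?cK //.
    by apply/subsetP=> r; rewrite in_setU1 => /orP [/eqP ->|/KN].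
  apply/subset_leq_card/subsetP=> z; rewrite inE in_set2 negb_or => /andP [/andP [zv zy] zF].
  rewrite in_setD in_setU1 negb_or zy /=; apply/andP; split.
    by apply/negP => zK; have := closed z y zK yK yv; rewrite setUAC zF.
  by apply: (nbhd_sub her zF); rewrite ?inE ?eqxx ?orbT.
(* If [a v] is at most 5, the degree sum gives [2 * b v] at most 6 + 2, so [b v] is at most 4 and
   [c v] at most 1. The total is then at most 10, against [deg_ge]. *)
rewrite ltnNge; apply/negP => a5.
have := link_sum her 2 v; rewrite (bigID (mem K)) /=.
rewrite (eq_big (mem K) (fun=> 2)); first last.
- by move=> y /andP [_ /pK].
- by move=> y /=; case: (boolP (y \in K)) => [/KN ->|]; rewrite ?andbF.
rewrite sum_nat_const cK => bE.
have : \sum_(y in N v | y \notin K) p v y <= (a v - 3) * (a v - 4).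
  apply: leq_trans (_ : \sum_(y in N v :\: K) (a v - 4) <= _).
    rewrite [leqRHS](eq_bigl (fun y => (y \in N v) && (y \notin K))).
      by apply: leq_sum => y /andP [yN yK]; apply: pout.
    by move=> y; rewrite in_setD andbC.
  rewrite sum_nat_const cardsD (setIidPr _) ?card_nbhd ?cK //.
  by apply/subsetP=> r /KN.
have : (a v - 3) * (a v - 4) <= 2 by case: (a v) a5 => [|[|[|[|[|[|]]]]]].
have := deg_ge v; have [_ _ _ + _] := link_bounds her v.
move: a5 bE; clear; move: (\sum_(_ in _ | _) _) => s.
lia.
Qed.

End Tips.

(** * Discharging *)

Section Discharging.

Variables (V : finType) (F : {set {set V}}).
Hypothesis her : hereditary F.
Implicit Types (A B C S : {set V}) (x y z u v w : V).

Local Notation a x := (deg F 2 [set x]).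
Local Notation b x := (deg F 3 [set x]).
Local Notation c x := (deg F 4 [set x]).
Local Notation p x y := (deg F 3 [set x; y]).
Local Notation q x y := (deg F 4 [set x; y]).
Local Notation N := (nbhd F).
Local Notation typeA := (typeA F).
Local Notation typeB := (typeB F).
Local Notation low := (low F).

Hypothesis deg_ge : forall x, 11 <= a x + b x + c x.

Definition weight x := 60 + 30 * a x + 20 * b x + 15 * c x.

Definition low_bases x := [forall u in N x, (q x u == 2) ==> low u].

(* The charge sent by [v] to a low neighbour [x]: in type A, bases send 4 and tips 2, or 4
   if both bases are low; in type B, bases send 2 and the tip 3. Low points send nothing. *)
Definition charge v x :=
  if [&& low x, ~~ low v & x \in N v] then
    2 * q v x + 3 * (typeB x && (q v x == 0))
      + 2 * [&& typeA x, q v x == 1 & low_bases x]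
  else 0.

Lemma sum4_le (f : V -> nat) n1 n2 n3 n4 : uniq [:: n1; n2; n3; n4] ->
  f n1 + f n2 + f n3 + f n4 <= \sum_v f v.
Proof.
move=> u; rewrite [leqRHS](bigID (mem [:: n1; n2; n3; n4])) /=.
apply: leq_trans (leq_addr _ _); rewrite -big_uniq //=.
by rewrite !big_cons big_nil addn0 !addnA.
Qed.

(** Type A lacks 8: it gets 4 + 4 from two non-low bases, 4 + 2 + 2 if one base is low, and 4 + 4
    from the tips if both are, since a low base makes the tips non-low. Type B lacks 3: it gets 3
    from a non-low tip, and otherwise 2 from each base. *)
Lemma charge_received x : low x -> 318 <= weight x + \sum_v charge v x.
Proof.
move=> lx; have ch v : v \in N x -> ~~ low v -> charge v x =
    2 * q x v + 3 * (typeB x && (q x v == 0))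
      + 2 * [&& typeA x, q x v == 1 & low_bases x].
  by move=> vN lv; rewrite /charge lx lv nbhdC vN qC.
case/orP: (lx) => [Ax|Bx].
  have [u1 [u2 [v1 [v2 [[uN Nx] _ [q1 q2 q3 q4] _ _]]]]] := typeA_struct her Ax.
  have [M1 M2 M3 M4] : [/\ u1 \in N x, u2 \in N x, v1 \in N x & v2 \in N x].
    by rewrite !Nx !inE !eqxx ?orbT.
  apply: leq_trans (leq_add (leqnn _) (sum4_le _ uN)).
  have -> : weight x = 310 by case/and3P: Ax => /eqP e1 /eqP e2 /eqP e3; rewrite /weight e1 e2 e3.
  have tip v u : v \in N x -> q x v = 1 -> low v -> u \in N x -> q x u = 2 -> ~~ low u.
    by move=> vN qv lv uNx; apply: (typeA_low_tip her Ax vN).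
  have dU u : u \in N x -> q x u = 2 -> ~~ low u -> 4 <= charge u x.
    by move=> uNx qu lu; rewrite ch // qu.
  have dV v : v \in N x -> q x v = 1 -> ~~ low v -> 2 + 2 * low_bases x <= charge v x.
    by move=> vNx qv lv; rewrite ch // qv Ax andbF.
  have lbE : low_bases x = low u1 && low u2.
    apply/forall_inP/andP => [lb|[l1 l2] u].
      by rewrite (implyP (lb u1 M1)) ?q1 // (implyP (lb u2 M2)) ?q2.
    by rewrite Nx !inE => /or4P [] /eqP ->; rewrite ?q1 ?q2 ?q3 ?q4.
  have [l1|l1] := boolP (low u1); last first.
    have [l2|l2] := boolP (low u2); last first.
      by have := dU u1 M1 q1 l1; have := dU u2 M2 q2 l2; clear; lia.
    have t1 : ~~ low v1 by apply/negP => /(tip v1 u2)-/(_ M3 q3 M2 q2); rewrite l2.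
    have t2 : ~~ low v2 by apply/negP => /(tip v2 u2)-/(_ M4 q4 M2 q2); rewrite l2.
    by have := dU u1 M1 q1 l1; have := dV v1 M3 q3 t1; have := dV v2 M4 q4 t2; clear; lia.
  have t1 : ~~ low v1 by apply/negP => /(tip v1 u1)-/(_ M3 q3 M1 q1); rewrite l1.
  have t2 : ~~ low v2 by apply/negP => /(tip v2 u1)-/(_ M4 q4 M1 q1); rewrite l1.
  have := dV v1 M3 q3 t1; have := dV v2 M4 q4 t2; rewrite lbE l1 /=.
  have [l2|l2] := boolP (low u2); first by clear; lia.
  by have := dU u2 M2 q2 l2; clear; lia.
have [u1 [u2 [u3 [v [[uN Nx] _ [q1 q2 q3 q4] _]]]]] := typeB_struct her Bx.
have [M1 M2 M3 M4] : [/\ u1 \in N x, u2 \in N x, u3 \in N x & v \in N x].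
  by rewrite !Nx !inE !eqxx ?orbT.
apply: leq_trans (leq_add (leqnn _) (sum4_le _ uN)).
have -> : weight x = 315 by case/and3P: Bx => /eqP e1 /eqP e2 /eqP e3; rewrite /weight e1 e2 e3.
have [lv|lv] := boolP (low v); last first.
  by have : 3 <= charge v x; [by rewrite ch // q4 Bx | clear; lia].
have t1 := typeB_low_tip her Bx M4 q4 lv M1 q1.
have t2 := typeB_low_tip her Bx M4 q4 lv M2 q2.
have : 2 <= charge u1 x by rewrite ch // q1 Bx.
have : 2 <= charge u2 x by rewrite ch // q2 Bx.
clear; lia.
Qed.

Lemma charge_le v x : charge v x <= 4 /\ charge v x <= 2 * p v x.
Proof.
rewrite /charge; case: ifP => // /and3P [lx _ xN]; have vN : v \in N x by rewrite nbhdC.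
rewrite pC qC; case/orP: lx => [Ax|Bx].
  rewrite typeAB //; have [[-> ->]|[-> ->]] := typeA_nbr her Ax vN; lia.
have -> : typeA x = false by apply/negP => /typeAB; rewrite Bx.
by have [-> [->|->]] := typeB_nbr her Bx vN; lia.
Qed.

(** Without 4-sets through [v], the only low neighbours are type B points with tip [v], where the
    charge 3 equals [p v x]. *)
Lemma charge_c0 v x : c v = 0 -> charge v x <= p v x.
Proof.
move=> c0; rewrite /charge; case: ifP => // /and3P [lx _ xN].
have vN : v \in N x by rewrite nbhdC.
have q0 : q x v = 0.
  have := @deg_subset _ F 4 [set v] [set x; v] (subsetUr _ _).
  by rewrite c0 leqn0 => /eqP.
rewrite pC qC q0; case/orP: lx => [Ax|Bx].
  by have [[_]|[_]] := typeA_nbr her Ax vN; rewrite q0.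
by have [-> _] := typeB_nbr her Bx vN; rewrite andbF; case: (typeB x).
Qed.

(** Both extra terms of [charge] vanish: one by assumption, the other because [typeA_tip_large]
    would give [v] six neighbours. *)
Lemma charge_small v x : a v <= 5 ->
  (forall y, typeB y -> y \in N v -> q v y <> 0) -> charge v x <= 2 * q v x.
Proof.
move=> a5 nB; rewrite /charge; case: ifP => // /and3P [lx _ xN].
have vN : v \in N x by rewrite nbhdC.
have -> : typeB x && (q v x == 0) = false.
  by apply/negP => /andP [Bx /eqP]; apply: nB.
have -> : [&& typeA x, q v x == 1 & low_bases x] = false.
  apply/negP => /and3P [Ax /eqP q1 /forall_inP lb]; move: a5; rewrite leqNgt => /negP; apply.
  apply: (typeA_tip_large her deg_ge Ax vN); first by rewrite qC.
  by move=> u /lb/implyP h /eqP.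
by rewrite !addn0.
Qed.

(* A 4-set through [v] avoids [x], hence is determined when [v] has only 4 neighbours,
   and its shadow is disjoint from the three 3-sets through [v] and [x]. *)
Lemma typeB_tip v x : typeB x -> x \in N v -> q v x = 0 ->
  (a v = 4 -> c v <= 1) /\ (0 < c v -> 6 <= b v).
Proof.
move=> Bx xN q0; have vN : v \in N x by rewrite nbhdC.
have xS S : S \in F -> #|S| = 4 -> v \in S -> x \notin S.
  move=> SF cS vS; apply/negP => xS; have : 0 < deg F #|S| [set v; x].
    by apply: deg_gt0; rewrite // subUset !sub1set vS.
  by rewrite cS q0.
split=> [a4|].
  rewrite -[leqRHS](cards1 ((v |: N v) :\ x)).
  apply/subset_leq_card/subsetP=> S; rewrite !inE sub1set => /and3P [SF /eqP cS vS].
  rewrite eqEcard; apply/andP; split.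
    rewrite subsetD1; apply/andP; split; last exact: xS.
    apply/subsetP=> y yS; rewrite in_setU1.
    by have [//|yv] := eqVneq y v; apply: (nbhd_sub her SF).
  have : #|v |: N v| = 5 by rewrite cardsU1 card_nbhd // a4 mem_nbhd eqxx.
  by rewrite cS (cardsD1 x) in_setU1 xN orbT add1n => -[->].
case/card_gt0P=> S; rewrite !inE sub1set => /and3P [SF /eqP cS vS].
have px : p v x = 3 by rewrite pC; have [] := typeB_nbr her Bx vN.
rewrite /deg -(cardsID [set R : {set V} | x \in R]); apply: (@leq_add 3 3).
  rewrite -[leqLHS]px; apply/subset_leq_card/subsetP=> R; rewrite !inE subUset !sub1set.
  by case/and3P=> -> -> /andP [-> ->].
apply: leq_trans (card_shadow her SF cS vS) _.
apply/subset_leq_card/subsetP=> R; rewrite !inE => /and3P [RF h RS]; rewrite RF h.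
rewrite !andbT; apply/negP => xR; have := xS S SF cS vS.
by rewrite (subsetP RS x xR).
Qed.

(** Summing the bounds per neighbour leaves a linear problem in [(a, b, c)]. It is tight at
    [(5, 6, 0)] and [(4, 6, 2)], where the excess 12 equals [2 * b v] and [6 * c v] respectively. *)
Lemma charge_given v : ~~ low v -> 318 + \sum_x charge v x <= weight v.
Proof.
move=> lv; have sN (f : V -> nat) : (forall x, charge v x <= f x) ->
    \sum_x charge v x <= \sum_(x in N v) f x.
  move=> cf; rewrite [leqRHS]big_mkcond; apply: leq_sum => x _.
  by case: ifP => // xN; rewrite /charge xN !andbF.
have D4a : \sum_x charge v x <= a v * 4.
  have := sN (fun=> 4) (fun x => (charge_le v x).1).
  by rewrite sum_nat_const card_nbhd.
have D4b : \sum_x charge v x <= 4 * b v.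
  have := sN _ (fun x => (charge_le v x).2).
  by rewrite -big_distrr /= link_sum // mulnA.
have D2b : c v = 0 -> \sum_x charge v x <= 2 * b v.
  by move=> c0; have := sN _ (fun x => charge_c0 x c0); rewrite link_sum.
(* Either alternative contradicts [typeB_tip], so [v] is not the tip of a type B point. *)
have D6c : a v <= 5 -> (a v = 4 /\ 1 < c v) \/ (0 < c v /\ b v < 6) ->
    \sum_x charge v x <= 6 * c v.
  move=> a5 h; have := sN (fun x => 2 * q v x); rewrite -big_distrr /= link_sum // mulnA.
  apply=> x; apply: charge_small => // y By yN q0.
  by have [] := typeB_tip By yN q0; lia.
have := deg_ge v; have [] := link_bounds her v; move: lv D4a D4b D2b D6c.
rewrite /low /typeA /typeB /weight.
move: (\sum_x _) (a v) (b v) (c v) => D i j k; clear; lia.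
Qed.

(** Charges sent and received have the same total and cancel. *)
Lemma sum_weight_ge : 318 * #|V| <= \sum_x weight x.
Proof.
have : \sum_x (318 + \sum_y charge x y) <= \sum_x (weight x + \sum_y charge y x).
  apply: leq_sum => x _; have [lx|lx] := boolP (low x); last first.
    exact: leq_trans (charge_given lx) (leq_addr _ _).
  rewrite (_ : \sum_y charge x y = 0) ?addn0 ?charge_received //.
  by apply: big1 => y _; rewrite /charge lx andbF.
rewrite 2!big_split /= [X in _ <= _ + X]exchange_big /= leq_add2r.
by rewrite sum_nat_const mulnC.
Qed.

End Discharging.

(** * From weights to arrows *)

Section Counting.

Variables (V : finType) (F : {set {set V}}).
Hypothesis her : hereditary F.

Lemma deg_sum_size k A :
  deg F k A = \sum_(S in F | A \subset S) (#|S| == k).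
Proof.
rewrite degE [LHS]big_mkcond [RHS]big_mkcond; apply: eq_bigr => S _.
by case: (S \in F); case: (A \subset S) => //=; rewrite ?andbF ?andbT //; case: eqP.
Qed.

(** The singleton accounts for one of the 12 sets. If [x] lies in a set of at least 5 points, a
    5-subset through [x] gives [c] at least 4, hence [b] at least 6 and [a] at least 4. *)
Lemma deg_ge_of_degree x : 12 <= #|[set S in F | x \in S]| ->
  11 <= deg F 2 [set x] + deg F 3 [set x] + deg F 4 [set x].
Proof.
move=> d12; have [/exists_inP [S SF /andP [xS S5]]|/exists_inPn small] :=
    boolP [exists S in F, (x \in S) && (5 <= #|S|)].
  have [|||R [xR RS R5]] := @subset_between _ [set x] S 5; rewrite ?sub1set ?cards1 //.
  have RF := hereditary_sub her SF RS; rewrite sub1set in xR.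
  have c4 := leq_trans (card_shadow her RF R5 xR) (shadow_le _ _ _ _).
  have := a_ge4 her (c_gt2_b her (ltnW c4)); have := c_gt2_b her (ltnW c4).
  by move: c4; clear; lia.
have d1 : deg F 1 [set x] <= 1 by rewrite -{1}(cards1 x) deg_self; case: (_ \in F).
suff : #|[set S in F | x \in S]| <=
  deg F 1 [set x] + deg F 2 [set x] + deg F 3 [set x] + deg F 4 [set x].
  by move: d1 d12; clear; lia.
rewrite !deg_sum_size -!big_split /= -sum1_card.
rewrite (eq_bigl (fun S => (S \in F) && ([set x] \subset S))); last first.
  by move=> S; rewrite inE sub1set.
apply: leq_sum => S /andP [SF]; rewrite sub1set => xS.
have := small S SF; rewrite xS /= -leqNgt.
have : 0 < #|S| by apply/card_gt0P; exists x.
by case: #|S| => [|[|[|[|[|]]]]].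
Qed.

(** Summed over all points, the weights count each nonempty member of size at most 4 exactly 60
    times; the term 10 comes from the empty set. *)
Lemma hereditary_card_ge : 0 < #|V| ->
  (forall x, 12 <= #|[set S in F | x \in S]|) -> 53 * #|V| + 10 <= 10 * #|F|.
Proof.
move=> V0 d12; have dg x := deg_ge_of_degree (d12 x).
have sub1 x : [set x] \in F /\ set0 \in F.
  have : 0 < #|[set S in F | x \in S]| by apply: leq_trans (d12 x).
  case/card_gt0P=> S; rewrite inE => /andP [SF xS].
  by split; apply: hereditary_sub her SF _; rewrite ?sub1set ?sub0set.
have d0 : deg F 0 set0 = 1.
  case/card_gt0P: V0 => x _; have [_ s0] := sub1 x.
  by rewrite -{1}(cards0 V) deg_self s0.
have dk k : \sum_x deg F k [set x] = k * deg F k set0.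
  have := deg_sum F k set0; rewrite cards0 subn0 => <-.
  by apply: eq_big => x; rewrite ?in_set0 // setU0.
have dV : #|V| = deg F 1 set0.
  rewrite -[RHS]mul1n -dk -sum1_card; apply: eq_bigr => x _.
  by rewrite -{2}(cards1 x) deg_self (sub1 x).1.
have dF : deg F 0 set0 + deg F 1 set0 + deg F 2 set0 + deg F 3 set0 + deg F 4 set0 <= #|F|.
  rewrite !deg_sum_size -!big_split /= -sum1_card.
  rewrite [leqRHS](eq_bigl (fun S => (S \in F) && (set0 \subset S))); last first.
    by move=> S; rewrite sub0set andbT.
  by apply: leq_sum => S _; case: #|S| => [|[|[|[|[|]]]]].
have := sum_weight_ge her dg; rewrite /weight 3!big_split /= -!big_distrr /= !dk.
rewrite sum_nat_const; move: dF; rewrite d0 -dV.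
move: (deg F 2 set0) (deg F 3 set0) (deg F 4 set0) #|F| #|V|; clear; lia.
Qed.

End Counting.

Lemma card_pred_setC1 n (T : {set 'I_n}) : 0 < n -> #|T| = n.-1 ->
  exists x, T = ~: [set x].
Proof.
move=> n0 cT; have : #|~: T| = 1 by have := cardsC T; rewrite cT card_ord; lia.
by move/eqP/cards1P => [x e]; exists x; rewrite -e setCK.
Qed.

Lemma traceS (V : finType) (F G : {set {set V}}) T :
  F \subset G -> trace F T \subset trace G T.
Proof. exact: imsetS. Qed.

(** Cut the family down to exactly [m] sets and compress. By [hereditary_card_ge] some point then
    has degree at most 11, and its complement serves as [T]. *)
Lemma arrow_small n m : 0 < n -> 10 * m <= 53 * n -> arrow n m n.-1 (m - 11).
Proof.
move=> n0 mn; apply/forallP=> F; apply/implyP=> mF.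
have [||| F0 [_ F0F cF0]] := @subset_between _ set0 F m; rewrite ?sub0set ?cards0 //.
have [G [her cG tG]] := hereditary_compression F0.
have [/existsP [x]|] := boolP [exists x, #|[set S in G | x \in S]| < 12].
  move=> d11; apply/existsP; exists (~: [set x]).
  rewrite cardsC1 card_ord eqxx /=.
  have := subset_leq_card (traceS (~: [set x]) F0F); have := tG (~: [set x]).
  have := card_trace_hereditary x her; rewrite cG cF0 => e h1 h2; apply: leq_trans (leq_trans h1 h2).
  by rewrite leq_subLR -e [11 + _]addnC leq_add2l.
move/existsPn=> d12; have := @hereditary_card_ge _ _ her.
rewrite cG cF0 card_ord => h; suff : 53 * n + 10 <= 10 * m by lia.
by apply: h => // x; rewrite leqNgt d12.
Qed.

(** Pad [F0] with arbitrary sets up to [m] members. Deleting a point merges at least 12 pairs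
    already within [F0], so at most [m - 12] traces remain; no truncation occurs since [m] is at
    least 12. *)
Lemma arrow_large n m (F0 : {set {set 'I_n}}) : 0 < n -> hereditary F0 ->
  (forall x, 12 <= #|[set S in F0 | x \in S]|) -> #|F0| <= m -> m <= expn 2 n ->
  ~~ arrow n m n.-1 (m - 11).
Proof.
move=> n0 her d12 cF m2.
have [|||F [F0F _ cF']] := @subset_between _ F0 setT m; rewrite ?subsetT //.
  by rewrite -powersetT card_powerset cardsT card_ord.
apply/negP => /forallP /(_ F); rewrite cF' leqnn /= => /existsP [T /andP [/eqP cT]].
have [x ->] := card_pred_setC1 n0 cT.
have : #|trace F (~: [set x])| <= #|trace F0 (~: [set x])| + #|F :\: F0|.
  apply: leq_trans (_ : #|trace F0 (~: [set x]) :|: trace (F :\: F0) (~: [set x])| <= _).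
    by rewrite /trace -imsetU setDE setUIr setUCr setIT (setUidPr F0F).
  apply: leq_trans (leq_card_setU _ _) _.
  by rewrite leq_add2l leq_imset_card.
rewrite cardsD (setIidPr F0F) cF'.
move=> h1 h2; have e := card_trace_hereditary x her; have d := d12 x.
move: h1 h2 e d cF; move: #|trace F _| #|trace F0 _| #|[set S in F0 | x \in S]| #|F0|.
by clear; lia.
Qed.

(** * The construction and the limit *)

(** The block is encoded by increasing lists of numbers so that its finite properties can be checked
    by computation. *)
Definition sublists (s : seq nat) : seq (seq nat) :=
  foldr (fun x ss => ss ++ map (cons x) ss) [:: [::]] s.

Definition half_block o : seq (seq nat) :=
  [seq l <- sublists (iota o 5) | (0 < size l <= 3) || (l == iota o 4)].

Definition block : seq (seq nat) := half_block 0 ++ half_block 5 ++ [:: [:: 4; 9]].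

Lemma size_block : size block = 53. Proof. by vm_compute. Qed.
Lemma uniq_block : uniq block. Proof. by vm_compute. Qed.

(** A listed set determines its list, which makes [translate] injective on the block. *)
Lemma block_canonical (l : seq nat) : l \in block -> l = [seq y <- iota 0 10 | y \in l].
Proof.
have : all (fun l : seq nat => l == [seq y <- iota 0 10 | y \in l]) block by vm_compute.
by move/allP => h /h/eqP.
Qed.

Lemma block_rem l y : l \in block -> y < 10 ->
  [seq z <- l | z != y] = [::] \/ [seq z <- l | z != y] \in block.
Proof.
have : all (fun l : seq nat => all (fun y : nat => let l' := [seq z <- l | z != y] in
  (l' == [::]) || (l' \in block)) (iota 0 10)) block by vm_compute.
move/allP => h /h/allP {}h y10; have := h y; rewrite mem_iota /= => /(_ y10).
by case/orP => [/eqP|]; [left|right].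
Qed.

Lemma block_degree y : y < 10 -> 12 <= size [seq l : seq nat <- block | y \in l].
Proof.
have : all (fun y : nat => 12 <= size [seq l : seq nat <- block | y \in l]) (iota 0 10) by vm_compute.
by move/allP => h y10; apply: h; rewrite mem_iota.
Qed.

Section Construction.

Variables (n : nat).

(** The guard [o <= i] is needed because truncated subtraction sends every smaller [i] to 0. *)
Definition translate o (l : seq nat) : {set 'I_n} :=
  [set i : 'I_n | (o <= i) && (i - o \in l)].

Definition blocks (os : seq nat) : {set {set 'I_n}} :=
  set0 |: [set S | S \in [seq translate o l | o <- os, l <- block]].

Lemma card_blocks os : #|blocks os| <= 53 * size os + 1.
Proof.
apply: leq_trans (leq_card_setU _ _) _; rewrite cards1 addnC leq_add2r cardsE.
by apply: leq_trans (card_size _) _; rewrite size_allpairs size_block mulnC.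
Qed.

Lemma hereditary_blocks os : hereditary (blocks os).
Proof.
move=> S x; rewrite !in_setU1 !inE => /orP [/eqP ->|]; first by rewrite set0D eqxx.
case/allpairsP=> -[o l] /= [oin lin ->].
have [y10|y10] := ltnP (x - o) 10; last first.
  rewrite setD1_id ?(allpairs_f _ oin lin) ?orbT // inE negb_and; apply/orP; right.
  rewrite (block_canonical lin) mem_filter mem_iota /= add0n ltnNge y10 /= andbF //.
have [ox|ox] := leqP o x; last first.
  by rewrite setD1_id ?(allpairs_f _ oin lin) ?orbT // inE leqNgt ox.
have -> : translate o l :\ x = translate o [seq z <- l | z != x - o].
  apply/setP=> i; rewrite !inE mem_filter; have [oi|//] := leqP o i; last by rewrite andbF.
  have -> // : (i != x) = (i - o != x - o).
  apply/idP/idP; apply: contra => /eqP; last by move=> ->.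
  by move=> e; apply/eqP/val_inj => /=; lia.
have [->|h] := block_rem lin y10; last by rewrite (allpairs_f _ oin h) orbT.
suff -> : translate o [::] = set0 by rewrite eqxx.
by apply/setP=> i; rewrite !inE in_nil andbF.
Qed.

Lemma degree_blocks os o (x : 'I_n) : o \in os -> o <= x < o + 10 -> o + 10 <= n ->
  12 <= #|[set S in blocks os | x \in S]|.
Proof.
move=> oin /andP [ox xo] on; have y10 : x - o < 10 by lia.
apply: leq_trans (block_degree y10) _; set L := filter _ _.
have inj : {in block &, injective (translate o)}.
  move=> l l' lin lin' e; rewrite (block_canonical lin) (block_canonical lin').
  apply: eq_in_filter => y; rewrite mem_iota /= add0n => yt.
  have yn : o + y < n by lia.
  by move/setP/(_ (Ordinal yn)): e; rewrite !inE /= addKn leq_addr.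
have LB : {subset L <= block} by move=> l; rewrite mem_filter => /andP [].
have uL : uniq (map (translate o) L).
  rewrite map_inj_in_uniq ?filter_uniq ?uniq_block // => l l' /LB h /LB h'.
  exact: inj.
rewrite -(size_map (translate o)) -(card_uniqP uL).
apply/subset_leq_card/subsetP=> _ /mapP [l + ->]; rewrite mem_filter => /andP [xl lin].
by rewrite !inE (allpairs_f _ oin lin) orbT ox xl.
Qed.

(** One block per started ten points; the last is moved back to fit into ['I_n] and may overlap its
    predecessor, which is harmless as only an upper bound on the number of sets is required. *)
Definition offsets := [seq minn (10 * j) (n - 10) | j <- iota 0 ((n + 9) %/ 10)].

Lemma degree_blocks_offsets (x : 'I_n) : 10 <= n ->
  12 <= #|[set S in blocks offsets | x \in S]|.
Proof.
move=> n10; have xn := ltn_ord x.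
apply: (@degree_blocks _ (minn (10 * (x %/ 10)) (n - 10))); last by lia.
  by apply/mapP; exists (x %/ 10); rewrite // mem_iota; lia.
by lia.
Qed.

End Construction.

(* The [^] in the definition of [mns] is [Nat.pow], because Reals is loaded last. *)
Lemma Nat_pow_expn m n : Nat.pow m n = expn m n.
Proof. by elim: n => //= n ->; rewrite expnS. Qed.

Lemma mns_le n : 10 <= n -> mns n 11 <= 53 * ((n + 9) %/ 10).
Proof.
move=> n10; apply/bigmax_leqP => m am; rewrite leqNgt; apply/negP => lt.
have m2 : m <= expn 2 n by rewrite -Nat_pow_expn -ltnS ltn_ord.
have cm : #|blocks n (offsets n)| <= m.
  by apply: leq_trans (card_blocks _ _) _; rewrite size_map size_iota addn1.
have n0 : 0 < n by lia.
have := arrow_large n0 (@hereditary_blocks n _)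
  (fun x => degree_blocks_offsets x n10) cm m2.
by rewrite am.
Qed.

Lemma mns_ge n m : 10 <= n -> 10 * m <= 53 * n -> m <= mns n 11.
Proof.
move=> n10 mn.
(* Ensures that [m] lies in the range of the maximum defining [mns]. *)
have pow2 : 6 * n <= expn 2 n.
  elim: n n10 {mn} => // n IH; rewrite leq_eqVlt => /predU1P [<- //|n10].
  by have := IH n10; rewrite expnS; move: (expn 2 n) => k; lia.
have m2 : m < (Nat.pow 2 n).+1 by rewrite Nat_pow_expn; lia.
apply: (leq_bigmax_cond (Ordinal m2)) => /=.
by apply: arrow_small => //; lia.
Qed.

(* 11 = 2^(5-1) - 5 ; 5.3 = (2^5 - 5 - 1/2)/5 = 53/10 *)
Theorem mainTheorem1 :
  (forall n : nat, 0 < n -> 10 %| n -> 10 * mns n 11 = 53 * n) /\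
  ms_is 11 (Rdiv 53 10).
Proof.
split=> [n n0 /dvdnP [k nk]|].
  have n10 : 10 <= n by lia.
  have := mns_le n10; have := @mns_ge n (53 * k) n10; lia.
(* Rounding up to whole blocks costs at most 53 * 9 = 477 in [10 * mns n 11], and rounding down at
   most 9, so the quotient differs from 5.3 by less than [48 / n]. *)
move=> eps eps0; have [N hN] := INR_unbounded (48 / eps).
exists (maxn N 10) => n /leP; rewrite geq_max => /andP [Nn n10].
have up : 10 * mns n 11 <= 53 * n + 477 by have := mns_le n10; lia.
have lo : 53 * n <= 10 * mns n 11 + 9 by have := @mns_ge n ((53 * n) %/ 10) n10; lia.
move: (mns n 11) up lo => M up lo.
have {}up : (10 * INR M <= 53 * INR n + 477)%R.
  by rewrite !INR_IZR_INZ -!mult_IZR -plus_IZR; apply: IZR_le; lia.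
have {}lo : (53 * INR n <= 10 * INR M + 9)%R.
  by rewrite !INR_IZR_INZ -!mult_IZR -plus_IZR; apply: IZR_le; lia.
have Nn' : (INR N <= INR n)%R by apply: le_INR; apply/leP.
have n0 : (0 < INR n)%R by apply: lt_0_INR; apply/leP; lia.
have hn : (48 < eps * INR n)%R.
  have : (48 / eps < INR n)%R by lra.
  move/(Rmult_lt_compat_r eps _ _ eps0).
  rewrite /Rdiv Rmult_assoc Rinv_l ?Rmult_1_r; lra.
rewrite /R_dist; apply: Rabs_def1.
  apply: (Rmult_lt_reg_r (INR n)) => //.
  rewrite Rmult_minus_distr_r /Rdiv Rmult_assoc Rinv_l; lra.
apply: (Rmult_lt_reg_r (INR n)) => //.
rewrite Rmult_minus_distr_r /Rdiv Rmult_assoc Rinv_l; lra.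
Qed.
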